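(* Let $I$ and $J$ be compositions of $n$. The induced $HCl_n(0)$-supermodules $M_I$ and $M_J$ are isomorphic if and only if $HP(I)=HP(J)$.
   Context: For a composition $I=(i_1,\dots,i_r)$ of $n$, $\operatorname{Des}(I)=\{i_1,\dots,i_1+\cdots+i_{r-1}\}\subseteq[1,n-1]$, and the peak set is $HP(I)=\{a\in\operatorname{Des}(I):a\ne1,\ a-1\notin\operatorname{Des}(I)\}$. $HCl_n(0)$ is the complex superalgebra generated by even elements $T_1,\dots,T_{n-1}$ and odd elements $c_1,\dots,c_n$, with the relations $T_i^2=-T_i$, $T_iT_j=T_jT_i$ ($|i-j|>1$), $T_iT_{i+1}T_i=T_{i+1}T_iT_{i+1}$, $c_ic_j=-c_jc_i$ ($i\ne j$), $c_i^2=-1$, $T_ic_j=c_jT_i$ ($j\ne i,i+1$), $T_ic_i=c_{i+1}T_i$, and $(T_i+1)c_{i+1}=c_i(T_i+1)$. $H_n(0)$ is the subalgebra generated by the $T_i$. $S_I=\mathbb{C}\epsilon_I$ is the one-dimensional $H_n(0)$-module with $T_j\epsilon_I=-\epsilon_I$ if $j\in\operatorname{Des}(I)$ and $T_j\epsilon_I=0$ otherwise. $M_I=HCl_n(0)\otimes_{H_n(0)}S_I$ is a supermodule with basis $c_D\epsilon_I$ ($D\subseteq\{1,\dots,n\}$, where $c_D$ is the increasing product of the $c_d$, $d\in D$), with the parity of $c_D\epsilon_I$ equal to that of $|D|$. Isomorphism of supermodules means a grading-preserving $HCl_n(0)$-module isomorphism. *)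

(* Defs.v *)
From mathcomp Require Import all_boot all_algebra.
From mathcomp Require Import complex.
From mathcomp Require Import Rstruct.
Set Implicit Arguments. Unset Strict Implicit. Unset Printing Implicit Defensive.
Import GRing.Theory.
Local Open Scope ring_scope.

Definition C : fieldType := complex Rdefinitions.R.

Definition is_composition (n : nat) (I : seq nat) : Prop :=
  all (fun a => 0 < a)%N I /\ sumn I = n.

Fixpoint partial_sums (acc : nat) (s : seq nat) : seq nat :=
  match s with
  | [::] => [::]
  | a :: s' => (acc + a)%N :: partial_sums (acc + a)%N s'
  end.
(* belast x0 [:: x1; ..; xk] = [:: x0; x1; ..; x(k-1)]; behead drops x0, leaving
   all partial sums except the last (the last one is n). *)
Definition DesSet (I : seq nat) : seq nat := behead (belast 0%N (partial_sums 0 I)).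

Definition HP (I : seq nat) : seq nat :=
  [seq a <- DesSet I | (a != 1)%N && (a.-1 \notin DesSet I)].

(** The underlying space of M_I: C-span of the basis c_D eps_I, D subset {1..n}.
    Here 'I_n is 0-based: k : 'I_n stands for the generator c_{k+1}. *)
Definition V (n : nat) := {ffun {set 'I_n} -> C}.

Definition e0 (n : nat) : V n := [ffun E : {set 'I_n} => (E == set0)%:R].

Definition csgn n (E : {set 'I_n}) (j : 'I_n) : C :=
  (-1) ^+ #|[set d in E | (d < j)%N]|.

(** left multiplication by c_{j+1} on M_I, using c_i c_j = - c_j c_i, c_i^2 = -1 *)
Definition cact n (j : 'I_n) (v : V n) : V n :=
  [ffun E : {set 'I_n} => if j \in E then csgn E j * v (E :\ j)
             else - (csgn E j * v (j |: E))].

Definition cactN n (k : nat) (v : V n) : V n :=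
  match @insub _ (fun x => x < n)%N _ k with
  | Some j => cact j v
  | None => 0
  end.

Definition word_vec n (w : seq 'I_n) : V n := foldr (@cact n) (e0 n) w.

(** T_{i+1} (c_{w_1} ... c_{w_k} eps_I), computed with the relations
    T c_j = c_j T (j <> i+1,i+2), T_{i+1} c_{i+1} = c_{i+2} T_{i+1},
    T_{i+1} c_{i+2} = c_{i+1} T_{i+1} + c_{i+1} - c_{i+2}
    (from (T+1)c_{i+2} = c_{i+1}(T+1)), and T_j eps_I = -eps_I if j in Des(I),
    0 otherwise. *)
Fixpoint Tact n (I : seq nat) (i : nat) (w : seq 'I_n) : V n :=
  match w with
  | [::] => if (i.+1 \in DesSet I) then - e0 n else 0
  | d :: w' =>
      if (val d == i)%N then cactN i.+1 (Tact I i w')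
      else if (val d == i.+1)%N then
        cactN i (Tact I i w') + cactN i (word_vec w') - cactN i.+1 (word_vec w')
      else cact d (Tact I i w')
  end.

(** action of T_{i+1} on M_I (extended linearly from the basis c_D eps_I,
    c_D = increasing product, enum E is increasing) *)
Definition Top n (I : seq nat) (i : nat) (v : V n) : V n :=
  \sum_(E : {set 'I_n}) v E *: Tact I i (enum E).

Definition homog n (b : bool) (v : V n) : Prop :=
  forall E : {set 'I_n}, odd #|E| != b -> v E = 0.

Definition super_iso (n : nat) (I J : seq nat) : Prop :=
  exists f : {linear V n -> V n},
    bijective f /\
    (forall b v, homog b v -> homog b (f v)) /\
    (forall i v, (i.+1 < n)%N -> f (Top I i v) = Top J i (f v)) /\
    (forall (j : 'I_n) v, f (cact j v) = cact j (f v)).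

(* Main.v *)
From HB Require Import structures.
Require Import Defs.
From mathcomp Require Import all_boot all_algebra.
From mathcomp Require Import complex Rstruct ring zify.
Set Implicit Arguments. Unset Strict Implicit. Unset Printing Implicit Defensive.
Import GRing.Theory.
Local Open Scope ring_scope.

(** A homomorphism M_I -> M_J commuting with the Clifford generators is right
    multiplication by v = f(eps_I), and it is H_n(0)-linear iff v is an
    eigenvector of every T_p of M_J, with eigenvalue -1 or 0 according to
    whether p is in Des(I).  If Des(I) and Des(J) differ at the single position
    p, where p-1 is a descent (or p = 1) and p+1 is not, then the invertible
    element v = 1 +- c_p c_(p+1) qualifies; two descent sets with the same peaks
    are joined by a chain of such moves.  Conversely, if p is a peak of I but
    not of J, the eigenvector equations for T_(p-1) and T_p, which only involve
    c_(p-1), c_p, c_(p+1), already force v = 0. *)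

(** * Clifford generators as signed toggles of index sets *)

Definition toggle n (x : 'I_n) (E : {set 'I_n}) : {set 'I_n} :=
  [set y | (y == x) (+) (y \in E)].

Lemma in_toggle n (x y : 'I_n) E : (y \in toggle x E) = (y == x) (+) (y \in E).
Proof. by rewrite inE. Qed.

Lemma toggleK n (x : 'I_n) : involutive (toggle x).
Proof. by move=> E; apply/setP=> y; rewrite !in_toggle addKb. Qed.

Lemma toggleC n (x y : 'I_n) E : toggle x (toggle y E) = toggle y (toggle x E).
Proof. by apply/setP=> z; rewrite !in_toggle addbCA. Qed.

Lemma odd_card_toggle n (x : 'I_n) E : odd #|toggle x E| = ~~ odd #|E|.
Proof.
case: (boolP (x \in E)) => xE.
  have -> : toggle x E = E :\ x.
    by apply/setP=> y; rewrite !inE; case: eqVneq => // ->; rewrite xE.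
  by rewrite (cardsD1 x E) xE /= negbK.
have -> : toggle x E = x |: E.
  by apply/setP=> y; rewrite !inE; case: eqVneq => // ->; rewrite (negbTE xE).
by rewrite cardsU1 xE.
Qed.

Lemma signr_odd_eq (k l : nat) : odd k = odd l -> (-1) ^+ k = (-1) ^+ l :> C.
Proof. by move=> e; rewrite -signr_odd e signr_odd. Qed.

Lemma csgn_toggle n (e d : 'I_n) E :
  csgn (toggle e E) d = (-1) ^+ (e < d)%N * csgn E d.
Proof.
rewrite /csgn; case: (ltnP e d) => /= led; last first.
  rewrite expr0 mul1r; apply: signr_odd_eq; congr (odd _); apply: eq_card => y.
  by rewrite !inE; case: eqVneq => // ->; rewrite ltnNge led !andbF.
rewrite -exprD; apply: signr_odd_eq; rewrite add1n /=.
rewrite -(odd_card_toggle e); congr (odd _).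
apply: eq_card => y.
by rewrite !inE; case: eqVneq => // ->; rewrite led !andbT.
Qed.

Lemma csgn_succ n (a b : 'I_n) E :
  val b = (val a).+1 -> csgn E b = (-1) ^+ (a \in E) * csgn E a.
Proof.
move=> ab; rewrite /csgn -exprD; apply: signr_odd_eq; congr (odd _).
rewrite (cardsD1 a) inE ab ltnSn andbT; congr (_ + _)%N.
apply: eq_card => y; rewrite !inE ltnS leq_eqVlt -(inj_eq val_inj) /=.
by case: eqVneq => //= ->; rewrite ltnn andbF.
Qed.

(** Up to sign, c_d adds [d] to an index set or removes it, so one formula covers both cases. The
    extra sign when [d] is not in [E] is c_d^2 = -1. *)
Lemma cactE n (d : 'I_n) v E :
  cact d v E = (-1) ^+ (d \notin E) * csgn E d * v (toggle d E).
Proof.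
rewrite ffunE; case: ifP => dE /=.
  rewrite mul1r; congr (_ * v _); apply/setP=> y; rewrite !inE.
  by case: eqVneq => // ->; rewrite dE.
rewrite mulN1r mulNr; congr (- (_ * v _)); apply/setP=> y; rewrite !inE.
by case: eqVneq => // ->; rewrite dE.
Qed.

Lemma VaddE n (u v : V n) E : (u + v) E = u E + v E.
Proof. by rewrite ffunE. Qed.

Lemma VoppE n (v : V n) E : (- v) E = - v E.
Proof. by rewrite ffunE. Qed.

Lemma VscaleE n (k : C) (v : V n) E : (k *: v) E = k * v E.
Proof. by rewrite ffunE. Qed.

(** * The operators T_p in coordinates *)

(* With b = a+1 (0-based) and T eps = -s eps, the operator T sends eps,
   c_a eps, c_b eps, c_a c_b eps to -s eps, -s c_b eps, (1-s) c_a eps - c_b eps,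
   eps - (1-s) c_a c_b eps; the surrounding generators are inert. The position
   p of T_p is val b. *)
Definition hecke n (s : bool) (a b : 'I_n) (v : V n) : V n :=
  [ffun E : {set 'I_n} =>
    match a \in E, b \in E with
    | true, true => (s%:R - 1) * v E
    | true, false => (1 - s%:R) * v (toggle a (toggle b E))
    | false, true => - v E - s%:R * v (toggle a (toggle b E))
    | false, false => v (toggle a (toggle b E)) - s%:R * v E
    end].

Lemma heckeE n s (a b : 'I_n) v E : hecke s a b v E =
    match a \in E, b \in E with
    | true, true => (s%:R - 1) * v E
    | true, false => (1 - s%:R) * v (toggle a (toggle b E))
    | false, true => - v E - s%:R * v (toggle a (toggle b E))
    | false, false => v (toggle a (toggle b E)) - s%:R * v E
    end.
Proof. by rewrite ffunE. Qed.

Lemma hecke_is_linear n s (a b : 'I_n) : linear (hecke s a b).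
Proof.
move=> k u v; apply/ffunP=> E; rewrite !ffunE.
by case: (a \in E); case: (b \in E); rewrite /GRing.scale /=; ring.
Qed.

HB.instance Definition _ n s (a b : 'I_n) :=
  GRing.isLinear.Build C (V n) (V n) *:%R (hecke s a b) (hecke_is_linear s a b).

(** The adjacent [a] and [b] lie on the same side of [d], so toggling both leaves the sign of c_d
    unchanged. *)
Lemma hecke_cact_far n s (a b d : 'I_n) v : val b = (val a).+1 ->
  d != a -> d != b -> hecke s a b (cact d v) = cact d (hecke s a b v).
Proof.
move=> ab da db; apply/ffunP=> E.
have ea : (a == d) = false by rewrite eq_sym (negbTE da).
have eb : (b == d) = false by rewrite eq_sym (negbTE db).
have lts : (b < d)%N = (a < d)%N.
  by move: ab da db; rewrite -!(inj_eq val_inj) /=; lia.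
rewrite cactE !heckeE !cactE.
rewrite !csgn_toggle !in_toggle ea eb (negbTE da) (negbTE db) /= lts.
rewrite (toggleC b d) (toggleC a d).
by case: (a < d)%N; case: (a \in E); case: (b \in E); ring.
Qed.

Lemma neq_succ n (a b : 'I_n) : val b = (val a).+1 -> (a == b) = false.
Proof. by move=> /= ab; rewrite -(inj_eq val_inj) /= ab; lia. Qed.

Lemma hecke_cact_left n s (a b : 'I_n) v : val b = (val a).+1 ->
  hecke s a b (cact a v) = cact b (hecke s a b v).
Proof.
move=> ab; apply/ffunP=> E; have nab := neq_succ ab.
have nba : (b == a) = false by rewrite eq_sym.
rewrite cactE !heckeE !cactE.
rewrite !csgn_toggle !in_toggle !(csgn_succ E ab).
rewrite ?eqxx ?nab ?nba ?ltnn ?ab ?ltnNge ?leqnSn /=.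
rewrite !toggleK.
by case: (a \in E); case: (b \in E) => /=; ring.
Qed.

(** This is (T+1) c_b = c_a (T+1), solved for T c_b. *)
Lemma hecke_cact_right n s (a b : 'I_n) v : val b = (val a).+1 ->
  hecke s a b (cact b v) = cact a (hecke s a b v) + cact a v - cact b v.
Proof.
move=> ab; apply/ffunP=> E; have nab := neq_succ ab.
have nba : (b == a) = false by rewrite eq_sym.
rewrite !VaddE VoppE !cactE !heckeE !cactE.
rewrite !csgn_toggle !in_toggle !(csgn_succ E ab).
rewrite ?eqxx ?nab ?nba ?ltnn ?ab ?ltnSn /=.
rewrite !(toggleC b a) !toggleK.
by case: (a \in E); case: (b \in E) => /=; ring.
Qed.

Lemma hecke_e0 n s (a b : 'I_n) : val b = (val a).+1 ->
  hecke s a b (e0 n) = - s%:R *: e0 n.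
Proof.
move=> ab; apply/ffunP=> E; rewrite !ffunE.
have n0 (F : {set 'I_n}) x : x \in F -> (F == set0) = false.
  by move=> xF; apply/negP=> /eqP F0; rewrite F0 inE in xF.
have nab := neq_succ ab; have nba : (b == a) = false by rewrite eq_sym.
rewrite /GRing.scale /=.
case aE: (a \in E); case bE: (b \in E).
- by rewrite (n0 E a) //=; ring.
- by rewrite (n0 E a) // (n0 _ b) ?in_toggle ?nba ?eqxx ?bE //=; ring.
- by rewrite (n0 E b) // (n0 _ a) ?in_toggle ?nab ?eqxx ?aE //=; ring.
- by rewrite (n0 (toggle _ _) a) ?in_toggle ?nab ?eqxx ?aE //=; ring.
Qed.

(** * Agreement of the coordinate formula with the given action *)

Definition basis n (E : {set 'I_n}) : V n := [ffun F => (F == E)%:R].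

Lemma Vsum n (v : V n) : v = \sum_E v E *: basis E.
Proof.
apply/ffunP=> F; rewrite sum_ffunE (bigD1 F) //= !ffunE eqxx /GRing.scale /= mulr1.
rewrite big1 ?addr0 // => E EF; rewrite !ffunE eq_sym (negbTE EF).
by rewrite /GRing.scale /= mulr0.
Qed.

(** The letters act from the last to the first, so each new one is smaller than all those present:
    no sign and no square arises. *)
Lemma word_vec_sorted n (w : seq 'I_n) :
  sorted ltn (map val w) -> word_vec w = basis [set x in w].
Proof.
elim: w => [|d w IHw] /= srt.
  by apply/ffunP=> E; rewrite !ffunE; congr (_ == _)%:R; apply/setP=> x; rewrite !inE.
have {}IHw := IHw (path_sorted srt).
have dmin : all (ltn d) (map val w) by apply: order_path_min srt => x y z; apply: ltn_trans.
have {}dmin x : x \in w -> (d < x)%N by move=> xw; apply: (allP dmin); apply: map_f.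
rewrite IHw; apply/ffunP=> E; rewrite cactE !ffunE.
have -> : (toggle d E == [set x in w]) = (E == [set x in d :: w]).
  rewrite -(inj_eq (can_inj (toggleK d))) toggleK; congr (_ == _).
  apply/setP=> x; rewrite !inE; case: eqVneq => //= ->.
  by case dw: (d \in w) => //; move: (dmin _ dw); rewrite ltnn.
case: eqP => [->|]; last by rewrite mulr0.
rewrite !inE eqxx /= expr0 mul1r mulr1 /csgn.
rewrite (_ : [set _ in _ | _] = set0) ?cards0 //.
apply/setP=> x; rewrite !inE; case: eqVneq => [->|_] /=; first by rewrite ltnn.
by case xw: (x \in w) => //=; have := dmin _ xw; lia.
Qed.

Lemma word_vec_enum n (E : {set 'I_n}) : word_vec (enum E) = basis E.
Proof.
rewrite word_vec_sorted; first by congr basis; apply/setP=> x; rewrite inE mem_enum.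
rewrite sorted_map /enum_mem; apply: sorted_filter; first by move=> x y z; apply: ltn_trans.
by rewrite -enumT -sorted_map val_enum_ord iota_ltn_sorted.
Qed.

Lemma cactN_val n (j : 'I_n) v : cactN j v = cact j v.
Proof. by rewrite /cactN valK. Qed.

(** The recursion of [Tact] moves T past one letter at a time by the three commutation rules just
    proved for [hecke]. *)
Lemma Tact_hecke n (I : seq nat) (a b : 'I_n) (w : seq 'I_n) :
  val b = (val a).+1 ->
  Tact I a w = hecke (val b \in DesSet I) a b (word_vec w).
Proof.
move=> ab; elim: w => [|d w IHw] /=.
  by rewrite hecke_e0 // ab; case: (_ \in _); rewrite ?scaleN1r ?oppr0 ?scale0r.
have eb u : cactN a.+1 u = cact b u by rewrite -cactN_val ab.
case: eqP => [/val_inj ->|/eqP da].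
  by rewrite hecke_cact_left // -IHw; apply: eb.
case: eqP => [|/eqP db].
  rewrite -[in X in _ = X]ab => /val_inj ->.
  by rewrite hecke_cact_right // -IHw -eb -!cactN_val.
rewrite IHw hecke_cact_far //.
by move: db; rewrite -ab (inj_eq val_inj).
Qed.

Lemma Top_hecke n (I : seq nat) (a b : 'I_n) (v : V n) : val b = (val a).+1 ->
  Top I a v = hecke (val b \in DesSet I) a b v.
Proof.
move=> ab; rewrite {2}[v]Vsum linear_sum; apply: eq_bigr => E _.
by rewrite linearZ (Tact_hecke I _ ab) word_vec_enum.
Qed.

(** * The twist by an invertible Clifford element *)

(* Right multiplication by 1 + (-1)^s c_a c_b, for b = a+1: since c_a c_b is even
   it can be moved to the place of the a- and b-factors, so no further sign. *)
Definition twist n (s : bool) (a b : 'I_n) (v : V n) : V n :=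
  [ffun E : {set 'I_n} =>
    v E + (-1) ^+ s * ((-1) ^+ (a \notin E) * v (toggle a (toggle b E)))].

Lemma twistE n s (a b : 'I_n) v E : twist s a b v E =
  v E + (-1) ^+ s * ((-1) ^+ (a \notin E) * v (toggle a (toggle b E))).
Proof. by rewrite ffunE. Qed.

Lemma twist_is_linear n s (a b : 'I_n) : linear (twist s a b).
Proof.
by move=> k u v; apply/ffunP=> E; rewrite !(twistE, VaddE, VscaleE); ring.
Qed.

HB.instance Definition _ n s (a b : 'I_n) :=
  GRing.isLinear.Build C (V n) (V n) *:%R (twist s a b) (twist_is_linear s a b).

Lemma C2_neq0 : (2%:R : C) != 0.
Proof. exact: negbT (Num.Theory.pnatr_eq0 (complex Rdefinitions.R) 2). Qed.

(** As (c_a c_b)^2 = -1, the product (1 + c_a c_b)(1 - c_a c_b) equals 2. *)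
Lemma twistK n s (a b : 'I_n) v : val b = (val a).+1 ->
  twist (~~ s) a b (twist s a b v) = 2%:R *: v.
Proof.
move=> ab; have nab := neq_succ ab.
apply/ffunP=> E; rewrite VscaleE !twistE !in_toggle eqxx nab /=.
rewrite (toggleC a b) !toggleK.
by case: s; case: (a \in E) => /=; ring.
Qed.

Lemma twist_bij n s (a b : 'I_n) : val b = (val a).+1 -> bijective (twist s a b).
Proof.
move=> ab; exists (fun v => 2%:R^-1 *: twist (~~ s) a b v) => v.
  by rewrite twistK // scalerA mulVf ?C2_neq0 // scale1r.
by rewrite linearZ /= -{1}[s]negbK twistK // scalerA mulVf ?C2_neq0 // scale1r.
Qed.

Lemma twist_homog n s (a b : 'I_n) p v : homog p v -> homog p (twist s a b v).
Proof.
move=> hv E pE; rewrite twistE hv // [v _]hv ?mulr0 ?addr0 //.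
by rewrite !odd_card_toggle negbK.
Qed.

(** Right multiplication commutes with left multiplication. *)
Lemma twist_cact n s (a b d : 'I_n) v : val b = (val a).+1 ->
  twist s a b (cact d v) = cact d (twist s a b v).
Proof.
move=> ab; apply/ffunP=> E; have nab := neq_succ ab.
rewrite cactE !twistE !cactE !csgn_toggle !in_toggle.
rewrite (toggleC b d) (toggleC a d).
case: (eqVneq d a) => [->|da].
  by rewrite nab ltnn ab ltnNge leqnSn /=; case: (a \in E) => /=; ring.
case: (eqVneq d b) => [->|db].
  by rewrite ltnn ab ltnSn ?nab /=; case: (a \in E); case: (b \in E) => /=; ring.
have lts : (b < d)%N = (a < d)%N.
  by move: ab da db; rewrite -!(inj_eq val_inj) /=; lia.
rewrite lts /=.
by case: (a < d)%N; case: (d \in E); case: (a \in E) => /=; ring.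
Qed.

(** In the target, T eps = -(1-s) eps. For s = 0, T kills eps + c_a c_b eps; for s = 1, T negates
    eps - c_a c_b eps. So the eigenvalue is -s, as in the source. *)
Lemma twist_hecke_same n s (a b : 'I_n) v : val b = (val a).+1 ->
  twist s a b (hecke s a b v) = hecke (~~ s) a b (twist s a b v).
Proof.
move=> ab; apply/ffunP=> E; have nab := neq_succ ab.
have nba : (b == a) = false by rewrite eq_sym.
rewrite twistE !heckeE !twistE.
rewrite !in_toggle !eqxx nab nba /= !(toggleC b a) !toggleK.
by case: s; case: (a \in E); case: (b \in E) => /=; ring.
Qed.

(** When T eps = -eps, T+1 kills c_b eps, so T c_a c_b eps = (c_c (T+1) - c_a) c_b eps = -c_a c_b
    eps: the eigenvalue -1 persists. *)
Lemma twist_hecke_left n s (c a b : 'I_n) v :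
  val a = (val c).+1 -> val b = (val a).+1 ->
  twist s a b (hecke true c a v) = hecke true c a (twist s a b v).
Proof.
move=> ca ab; apply/ffunP=> E.
have nab := neq_succ ab; have nca := neq_succ ca.
have nba : (b == a) = false by rewrite eq_sym.
have nac : (a == c) = false by rewrite eq_sym.
have ncb : (c == b) = false.
  by move: ca ab; rewrite -(inj_eq val_inj) /=; lia.
rewrite twistE !heckeE !twistE.
rewrite !in_toggle ?eqxx ?(nab, nba, nac, nca, ncb) /=.
rewrite !(toggleC b c, toggleC a c, toggleC b a) !toggleK.
by case: s; case: (a \in E); case: (c \in E) => /=; ring.
Qed.

(** When T eps = 0, T c_a c_b eps = c_a c_c T eps = 0. *)
Lemma twist_hecke_right n s (a b c : 'I_n) v :
  val b = (val a).+1 -> val c = (val b).+1 ->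
  twist s a b (hecke false b c v) = hecke false b c (twist s a b v).
Proof.
move=> ab bc; apply/ffunP=> E.
have nab := neq_succ ab; have nbc := neq_succ bc.
have nba : (b == a) = false by rewrite eq_sym.
have ncb : (c == b) = false by rewrite eq_sym.
have nac : (a == c) = false.
  by move: ab bc; rewrite -(inj_eq val_inj) /=; lia.
have nca : (c == a) = false by rewrite eq_sym.
rewrite twistE !heckeE !twistE.
rewrite !in_toggle ?eqxx ?(nab, nba, nac, nca, ncb, nbc) /=.
rewrite !(toggleC c b, toggleC c a, toggleC b a) !toggleK.
by case: s; case: (a \in E); case: (b \in E); case: (c \in E) => /=; ring.
Qed.

Lemma twist_hecke_far n s t (a b c d : 'I_n) v :
  a != c -> a != d -> b != c -> b != d ->
  twist s a b (hecke t c d v) = hecke t c d (twist s a b v).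
Proof.
move=> ac ad bc bd; apply/ffunP=> E.
have [ca da cb db] : [/\ c != a, d != a, c != b & d != b] by split; rewrite eq_sym.
rewrite twistE !heckeE !twistE.
rewrite !in_toggle !(negbTE ac, negbTE ad, negbTE bc, negbTE bd).
rewrite !(negbTE ca, negbTE da, negbTE cb, negbTE db) /=.
rewrite !(toggleC d b, toggleC c b, toggleC d a, toggleC c a).
by case: s; case: (a \in E); case: (d \in E); case: (c \in E) => /=; ring.
Qed.

(** T at position [val d] meets c_a or c_b only if [val d] is the flipped position or one of its
    neighbours; the hypotheses on [D] are what the two neighbours need. *)
Lemma twist_hecke n (D D' : pred nat) (a b c d : 'I_n) v :
  val b = (val a).+1 -> val d = (val c).+1 ->
  (forall k, 0 < k < n -> k != val b -> D' k = D k)%N ->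
  D' (val b) = ~~ D (val b) ->
  (1 < val b -> D (val b).-1)%N -> ((val b).+1 < n -> ~~ D (val b).+1)%N ->
  twist (D (val b)) a b (hecke (D (val d)) c d v) =
    hecke (D' (val d)) c d (twist (D (val b)) a b v).
Proof.
move=> ab cd eqD flipD Dpred Dsucc.
have d_pos : (0 < val d < n)%N by rewrite cd ltnS leq0n -cd ltn_ord.
case: (eqVneq d b) => [db|db].
  have ca : c = a by apply: val_inj; move: cd; rewrite db ab => -[].
  by rewrite db ca flipD twist_hecke_same.
rewrite eqD //.
case: (eqVneq d a) => [da|da].
  rewrite da in cd d_pos *; have -> : D (val a).
    have -> : val a = (val b).-1 by rewrite ab.
    by apply: Dpred; rewrite ab; case/andP: d_pos.
  by rewrite twist_hecke_left.
case: (eqVneq c b) => [cb|cb].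
  rewrite cb in cd *; have -> : D (val d) = false.
    by apply: negbTE; rewrite cd; apply: Dsucc; rewrite -cd ltn_ord.
  by rewrite twist_hecke_right.
by rewrite twist_hecke_far // 1?eq_sym //;
  move: ab cd da db cb; rewrite -!(inj_eq val_inj) /=; lia.
Qed.

(** * Isomorphisms between descent sets with the same peaks *)

(** Descent sets are arbitrary predicates here, so that intermediate sets of a chain need not be
    presented by compositions. *)
Definition hecke_iso (n : nat) (D D' : pred nat) : Prop :=
  exists f : {linear V n -> V n},
    [/\ bijective f, forall p v, homog p v -> homog p (f v),
        forall (a b : 'I_n) v, val b = (val a).+1 ->
          f (hecke (D (val b)) a b v) = hecke (D' (val b)) a b (f v)
      & forall (j : 'I_n) v, f (cact j v) = cact j (f v)].

Lemma super_iso_hecke n I J :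
  super_iso n I J <-> hecke_iso n (mem (DesSet I)) (mem (DesSet J)).
Proof.
split=> [[f [fbij [fhom [fT fc]]]]|[f [fbij fhom fT fc]]]; exists f.
  split=> // a b v ab.
  rewrite -[hecke _ _ _ v]Top_hecke // -[hecke _ _ _ (f v)]Top_hecke //.
  by apply: fT; rewrite -[X in (X < _)%N]ab ltn_ord.
do 3!split=> //.
move=> i v lti.
have := fT (Ordinal (ltnW lti)) (Ordinal lti) v erefl.
by rewrite -[hecke _ _ _ v]Top_hecke // -[hecke _ _ _ (f v)]Top_hecke.
Qed.

Lemma hecke_iso_trans n D1 D2 D3 :
  hecke_iso n D1 D2 -> hecke_iso n D2 D3 -> hecke_iso n D1 D3.
Proof.
move=> [f [fb fh fT fc]] [g [gb gh gT gc]].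
exists (g \o f : {linear V n -> V n}); split.
- exact: bij_comp.
- by move=> p v /fh /gh.
- by move=> a b v ab /=; rewrite fT // gT.
- by move=> j v /=; rewrite fc gc.
Qed.

Lemma hecke_iso_refl n (D D' : pred nat) :
  (forall k, 0 < k < n -> D k = D' k)%N -> hecke_iso n D D'.
Proof.
move=> eqD; exists (idfun : {linear V n -> V n}); split=> //.
  by exists id.
by move=> a b v ab /=; rewrite eqD // ab ltnS leq0n -ab ltn_ord.
Qed.

Lemma hecke_iso_flip n (D D' : pred nat) p : (0 < p < n)%N ->
  (forall k, 0 < k < n -> k != p -> D' k = D k)%N -> D' p = ~~ D p ->
  (1 < p -> D p.-1)%N -> (p.+1 < n -> ~~ D p.+1)%N -> hecke_iso n D D'.
Proof.
case: p => // i /andP[_ lti] eqD flipD Dpred Dsucc.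
(* Position p = i+1 involves c_p and c_(p+1), whose 0-based indices are i and i+1. *)
pose a : 'I_n := Ordinal (ltnW lti); pose b : 'I_n := Ordinal lti.
have ab : val b = (val a).+1 by [].
exists (twist (D (val b)) a b : {linear V n -> V n}); split.
- exact: twist_bij.
- by move=> p v; apply: twist_homog.
- by move=> c d v cd; apply: twist_hecke.
- by move=> j v; apply: twist_cact.
Qed.

(** The condition k <> 1 is imposed at each use, through the range 1 < k < n. *)
Definition peak (D : pred nat) (k : nat) := D k && ~~ D k.-1.

(** Positions are scanned upwards. At the first disagreement [p], adding [p] to the set that lacks
    it is an admissible flip that keeps all peaks. *)
Lemma hecke_iso_peaks n (D D' : pred nat) :
  (forall k, 1 < k < n -> peak D k = peak D' k)%N -> hecke_iso n D D'.
Proof.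
(* Otherwise [p] would be a peak of [Y] only, or p+1 a peak of [X] only. *)
have flip_ok (X Y : pred nat) p : (forall k, 1 < k < n -> peak X k = peak Y k)%N ->
    (forall k, 0 < k < p -> X k = Y k)%N -> (0 < p < n)%N -> X p = false -> Y p ->
    (1 < p -> X p.-1)%N /\ (p.+1 < n -> ~~ X p.+1)%N.
  move=> eqP eqXY /andP[p0 ltpn] Xp Yp; split=> p1.
    have := eqP p; rewrite p1 ltpn /peak Xp Yp /= => /(_ isT) /esym /negbFE.
    by rewrite eqXY // prednK // leqnn andbT -ltnS prednK.
  have := eqP p.+1; rewrite /peak p1 /= Xp Yp andbT andbF ltnS p0 /=.
  by move/(_ isT); rewrite ?andbT => ->.
(* No peak appears at [p], since p-1 is in [X], and none is lost at p+1, since p+1 is not. *)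
have addp_peak (X : pred nat) p : (1 < p -> X p.-1)%N -> (p.+1 < n -> ~~ X p.+1)%N ->
    X p = false -> (forall k, 1 < k < n -> peak (fun j => (j == p) || X j) k = peak X k)%N.
  move=> Xpred Xsucc Xp k /andP[k1 kn]; rewrite /peak.
  case: (eqVneq k p) => [kp|_] /=.
    rewrite kp Xp Xpred ?orbT //; by rewrite -kp.
  case: (eqVneq k.-1 p) => [kp|//] /=.
  have kE : k = p.+1 by rewrite -kp prednK // ltnW.
  by rewrite kE (negbTE (Xsucc _)) // -kE.
suff agree m p (X Y : pred nat) : (0 < p)%N -> (n <= p + m)%N ->
    (forall k, 1 < k < n -> peak X k = peak Y k)%N ->
    (forall k, 0 < k < p -> X k = Y k)%N -> hecke_iso n X Y.
  by move=> eqDD'; apply: (agree n 1%N) => //; case.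
elim: m p X Y => [|m IHm] p X Y p0 np eqXY agr.
  apply: hecke_iso_refl => k /andP[k0 kn]; apply: agr.
  by rewrite k0 (leq_trans kn) // -[p]addn0.
case: (leqP n p) => [lenp|ltpn].
  by apply: hecke_iso_refl => k /andP[k0 kn]; rewrite agr // k0 (leq_trans kn).
have pn : (0 < p < n)%N by rewrite p0.
have IH X' Y' : (forall k, 1 < k < n -> peak X' k = peak Y' k)%N ->
    (forall k, 0 < k < p -> X' k = Y' k)%N -> X' p = Y' p -> hecke_iso n X' Y'.
  move=> eqX agr' eqp; apply: (IHm p.+1) => //; first by rewrite addSnnS.
  move=> k /andP[k0]; rewrite ltnS leq_eqVlt => /predU1P[-> //|kp].
  by rewrite agr' // k0.
have sub k : (0 < k < p)%N -> (k == p) = false by case/andP=> _ kp; rewrite ltn_eqF.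
case Xp: (X p); case Yp: (Y p).
- by apply: IH => //; rewrite Xp Yp.
(* Here [Y] is enlarged and the flip, removing [p], comes last; in the symmetric case [X] is
   enlarged and the flip comes first. *)
- have [Ypred Ysucc] : (1 < p -> Y p.-1)%N /\ (p.+1 < n -> ~~ Y p.+1)%N.
    by apply: flip_ok Xp => // k kk; rewrite ?eqXY ?agr.
  apply: (@hecke_iso_trans _ _ (fun j => (j == p) || Y j)).
    apply: IH => [k kn|k kp|]; first by rewrite addp_peak // eqXY.
      by rewrite sub //= agr.
    by rewrite eqxx.
  apply: (hecke_iso_flip pn) => [k _ /negbTE-> //| |p1|p1] /=.
  - by rewrite eqxx Yp.
  - by rewrite Ypred ?orbT.
  - by rewrite negb_or Ysucc // andbT gtn_eqF.
- have [Xpred Xsucc] : (1 < p -> X p.-1)%N /\ (p.+1 < n -> ~~ X p.+1)%N.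
    exact: flip_ok Yp.
  apply: (@hecke_iso_trans _ _ (fun j => (j == p) || X j)).
    by apply: (hecke_iso_flip pn) => [k _ /= /negbTE-> //| |p1|p1] /=;
      rewrite ?eqxx ?Xp ?Xpred ?Xsucc.
  apply: IH => [k kn|k kp|]; first by rewrite addp_peak // eqXY.
    by rewrite sub //= agr.
  by rewrite eqxx.
- by apply: IH => //; rewrite Xp Yp.
Qed.

(** * Eigenvectors of T and the obstruction from a peak *)

(** If T eps = 0, the kernel of T on the a- and b-factors is spanned by eps and c_a eps. *)
Lemma hecke_false_ker n (a b : 'I_n) (v : V n) (E : {set 'I_n}) :
  hecke false a b v = 0 -> b \in E -> v E = 0.
Proof.
move=> h bE; have := congr1 (fun u : V n => u E) h; rewrite heckeE !ffunE bE.
by case: (a \in E); rewrite ?sub0r ?mulN1r ?mul0r ?subr0 => /eqP;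
  rewrite oppr_eq0 => /eqP.
Qed.

(** If T eps = -eps, the kernel is spanned by eps + c_a c_b eps and c_a eps - c_b eps. *)
Lemma hecke_true_ker n (a b : 'I_n) (v : V n) (E : {set 'I_n}) : val b = (val a).+1 ->
  hecke true a b v = 0 ->
  v (toggle a (toggle b E)) = (-1) ^+ ((a \in E) (+) (b \in E)) * v E.
Proof.
move=> ab h; have nab := neq_succ ab.
have nba : (b == a) = false by rewrite eq_sym.
have hF F := congr1 (fun u : V n => u F) h.
case aE: (a \in E); case bE: (b \in E) => /=.
- have := hF (toggle a (toggle b E)).
  rewrite heckeE !ffunE !in_toggle !eqxx nab nba aE bE /=.
  rewrite !(toggleC b a) !toggleK mul1r.
  by rewrite expr0 mul1r => /eqP; rewrite subr_eq0 => /eqP->.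
- have := hF (toggle a (toggle b E)).
  rewrite heckeE !ffunE !in_toggle !eqxx nab nba aE bE /=.
  rewrite !(toggleC b a) !toggleK mul1r.
  by rewrite expr1 mulN1r => /eqP; rewrite subr_eq0 => /eqP <-; rewrite opprK.
- have := hF E; rewrite heckeE !ffunE aE bE mul1r.
  by rewrite expr1 mulN1r => /eqP; rewrite subr_eq0 => /eqP <-.
- have := hF E; rewrite heckeE !ffunE aE bE mul1r.
  by rewrite ?expr0 ?mul1r => /eqP; rewrite subr_eq0 => /eqP.
Qed.

(** If T eps = -eps, the (-1)-eigenspace is spanned by eps and c_b eps. *)
Lemma hecke_true_eigen n (a b : 'I_n) (v : V n) (E : {set 'I_n}) :
  hecke true a b v = - v -> a \in E -> v E = 0.
Proof.
move=> h aE; have := congr1 (fun u : V n => u E) h.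
rewrite heckeE !ffunE aE !subrr !mul0r if_same => /esym/eqP.
by rewrite oppr_eq0 => /eqP.
Qed.

(** If T eps = 0, the (-1)-eigenspace is spanned by eps - c_a c_b eps and c_a eps - c_b eps. *)
Lemma hecke_false_eigen n (a b : 'I_n) (v : V n) (E : {set 'I_n}) : val b = (val a).+1 ->
  hecke false a b v = - v ->
  v (toggle a (toggle b E)) = - v E.
Proof.
move=> ab h; have nab := neq_succ ab.
have nba : (b == a) = false by rewrite eq_sym.
have hF F := congr1 (fun u : V n => u F) h.
case aE: (a \in E); case bE: (b \in E) => /=.
- have := hF (toggle a (toggle b E)).
  rewrite heckeE !ffunE !in_toggle !eqxx nab nba aE bE /= !(toggleC b a) !toggleK.
  by rewrite mul0r subr0 => ->; rewrite opprK.
- have := hF E; rewrite heckeE !ffunE aE bE.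
  by rewrite subr0 mul1r.
- have := hF (toggle a (toggle b E)).
  rewrite heckeE !ffunE !in_toggle !eqxx nab nba aE bE /= !(toggleC b a) !toggleK.
  by rewrite subr0 mul1r => ->; rewrite opprK.
- have := hF E; rewrite heckeE !ffunE aE bE.
  by rewrite mul0r subr0.
Qed.

(** The flags [s] and [t] record whether p-1 and p are descents of the target, with p = [val z]; the
    third hypothesis says that p is not a peak there. *)
Lemma peak_eigen_eq0 n (x y z : 'I_n) (s t : bool) (v : V n) :
  val y = (val x).+1 -> val z = (val y).+1 -> ~~ (t && ~~ s) ->
  hecke s x y v = 0 -> hecke t y z v = - v -> v = 0.
Proof.
move=> xy yz st hs ht; apply/ffunP=> E; rewrite [RHS]ffunE.
have nxy := neq_succ xy; have nyz := neq_succ yz.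
have nyx : (y == x) = false by rewrite eq_sym.
case: s t st hs ht => [] [] //= _ hs ht.
(* Coefficients of sets containing [y] vanish by [ht], and toggling [x] and [y] relates the others
   to them up to sign. *)
- case yE: (y \in E); first exact: hecke_true_eigen ht yE.
  apply/eqP; rewrite -oppr_eq0; apply/eqP.
  have := hecke_true_ker E xy hs.
  rewrite (hecke_true_eigen ht) ?in_toggle ?nyx ?eqxx ?yE //.
  by case: (_ (+) _); rewrite ?expr1 ?expr0 ?mulN1r ?mul1r => /esym // ->; rewrite oppr0.
(* The two double toggles commute, but their signs do not: the sign of the x,y toggle changes once
   [y] is toggled. Comparing the two orders gives [v E = - v E]. *)
- have e1 := hecke_true_ker (toggle y (toggle z E)) xy hs.
  have e2 := hecke_true_ker E xy hs.
  have e3 F := hecke_false_eigen F yz ht.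
  have := e3 (toggle x (toggle y E)).
  have -> : toggle y (toggle z (toggle x (toggle y E))) =
            toggle x (toggle y (toggle y (toggle z E))).
    by rewrite (toggleC z x) (toggleC y x) (toggleC z y).
  rewrite e1 e2 e3 !in_toggle nxy eqxx nyz.
  have -> : (x == z) = false.
    by move: xy yz; rewrite -(inj_eq val_inj) /=; lia.
  have two_eq0 (k : C) : k = - k -> k = 0.
    move/eqP; rewrite -addr_eq0 -mulr2n -mulr_natl mulf_eq0 (negbTE C2_neq0).
    by move/eqP.
  by case: (x \in E); case: (y \in E) => /=;
    rewrite ?expr1 ?expr0 ?mulN1r ?mul1r ?opprK; move=> e; apply: two_eq0.
(* Now [hs] kills the sets containing [y], and the y,z toggle handles the rest. *)
- case yE: (y \in E); first exact: hecke_false_ker hs yE.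
  have := hecke_false_eigen E yz ht.
  rewrite (hecke_false_ker hs) ?in_toggle ?eqxx ?nyz ?yE //.
  by move/esym/eqP; rewrite oppr_eq0 => /eqP.
Qed.

Lemma e0_neq0 n : e0 n != 0.
Proof.
apply/eqP=> /(congr1 (fun u : V n => u set0)); rewrite !ffunE eqxx.
by apply/eqP; rewrite oner_eq0.
Qed.

Lemma peak_of_eigenvector n (D D' : pred nat) (v : V n) k : v != 0 ->
  (forall a b : 'I_n, val b = (val a).+1 ->
    hecke (D' (val b)) a b v = - (D (val b))%:R *: v) ->
  (1 < k < n)%N -> peak D k -> peak D' k.
Proof.
move=> v0 hv; case: k => [|[|i]] // /andP[_ lti] /andP[Dk Dk1].
(* With k = i+2, T_k acts on the indices [y], [z] and T_(k-1) on [x], [y]. *)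
pose y : 'I_n := Ordinal (ltnW lti); pose z : 'I_n := Ordinal lti.
pose x : 'I_n := Ordinal (ltnW (ltnW lti)).
apply: contraT => nD'; case/eqP: v0.
apply: (@peak_eigen_eq0 n x y z (D' (val y)) (D' (val z))) => //.
  by rewrite hv // [D _](negbTE Dk1) oppr0 scale0r.
by rewrite hv // [D _]Dk scaleN1r.
Qed.

Lemma peaks_hecke_iso n (D D' : pred nat) k :
  hecke_iso n D D' -> (1 < k < n)%N -> peak D k = peak D' k.
Proof.
case=> f [fbij _ fT _] kn; have [g gK fK] := fbij.
apply/idP/idP.
  apply: (@peak_of_eigenvector _ _ _ (f (e0 n)) _ _ _ kn) => [|a b ab].
    apply: contra_neq _ (e0_neq0 n) => fe0.
    by apply: (bij_inj fbij); rewrite fe0 linear0.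
  by rewrite -fT // hecke_e0 // linearZ.
(* The inverse [g] comes as a bare function, so its eigenvector equations are checked after applying
   the injective [f]. *)
apply: (@peak_of_eigenvector _ _ _ (g (e0 n)) _ _ _ kn) => [|a b ab].
  by apply: contra_neq _ (e0_neq0 n) => ge0; rewrite -[LHS]fK ge0 linear0.
apply: (bij_inj fbij).
by rewrite fT // fK hecke_e0 // linearZ /= fK.
Qed.

(** * Descent sets of compositions and the conclusion *)

Lemma partial_sums_sorted acc I : all (fun a => 0 < a)%N I ->
  sorted ltn (acc :: partial_sums acc I) /\
  last acc (partial_sums acc I) = (acc + sumn I)%N.
Proof.
elim: I acc => [|i I IHI] acc /=; first by rewrite addn0.
case/andP=> i0 Ipos; have [/= -> ->] := IHI (acc + i)%N Ipos.
by rewrite addnA -addn1 leq_add2l i0.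
Qed.

(** Positive parts give strictly increasing partial sums from 0 to n, and [DesSet] omits both
    ends. *)
Lemma mem_DesSet_lt n I k : is_composition n I -> k \in DesSet I -> (0 < k < n)%N.
Proof.
case=> /(partial_sums_sorted 0)[srt lst] sumI; rewrite add0n sumI in lst.
move: srt lst; rewrite /DesSet; case: (partial_sums 0 I) => // p s srt lst kD.
rewrite /= in kD lst.
have lt_last : all (ltn^~ n) (belast p s).
  have : sorted ltn (p :: s) by case/andP: srt.
  rewrite lastI lst.
  by rewrite (sorted_pairwise ltn_trans) pairwise_rcons => /andP[].
have gt0 : all (ltn 0) (p :: s) by exact: order_path_min ltn_trans srt.
by apply/andP; split; [apply: (allP gt0); apply: mem_belast | apply: (allP lt_last)].
Qed.

Lemma mem_HP n I k : is_composition n I ->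
  (k \in HP I) = (1 < k < n)%N && peak (mem (DesSet I)) k.
Proof.
move=> cI; rewrite mem_filter /peak /= andbC.
case kD: (k \in DesSet I); last by rewrite andbF.
have /andP[k0 ->] := mem_DesSet_lt cI kD.
by rewrite andbT; case: k k0 {kD} => [|[|k]].
Qed.

Theorem mainTheorem11 (n : nat) (I J : seq nat) :
  is_composition n I -> is_composition n J ->
  (super_iso n I J <-> HP I =i HP J).
Proof.
move=> cI cJ; rewrite super_iso_hecke; split=> [iso k|eqHP].
  rewrite (mem_HP _ cI) (mem_HP _ cJ); apply: andb_id2l => kn.
  exact: peaks_hecke_iso iso kn.
apply: hecke_iso_peaks => k kn.
by have := eqHP k; rewrite (mem_HP _ cI) (mem_HP _ cJ) kn.
Qed.
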